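(* Let $G$ be a graph and let $F:V(G)\to 2^{\mathbb{N}}$ where $|F(v)|<\frac{1}{2}d_G(v)$ for all $v\in V(G)$. Suppose that $G$ can be decomposed into a bipartite graph and a subgraph $H$ with $\Delta(H)\leq 2$ and such that every vertex $v\in V(H)$ with $d_H(v)=2$ has $d_G(v)\equiv 0\pmod 2$. Then $G$ admits an $F$-avoiding orientation.
   Context: All graphs are finite and loopless; parallel edges are permitted, and degrees count edges with multiplicity. $d_G(v)$ and $d_H(v)$ denote the degrees of $v$ in $G$ and $H$, and $\Delta(H)$ is the maximum degree of $H$. That $G$ decomposes into a bipartite graph and $H$ means that $E(G)$ is partitioned into the edge set of a bipartite subgraph of $G$ and the edge set of the subgraph $H$. $\mathbb{N}$ includes $0$, and $2^{\mathbb{N}}$ is the set of all subsets of $\mathbb{N}$. An orientation $D$ of $G$ assigns a direction to each edge, so that each edge points out of one endpoint and into the other; $d_D^+(v)$ is the number of edges pointing out of $v$. The orientation $D$ is $F$-avoiding if $d_D^+(v)\notin F(v)$ for all $v\in V(G)$. *)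

(* Defs.v *)
From mathcomp Require Import all_boot finmap.
From mathcomp Require Import boolp classical_sets cardinality.

Set Implicit Arguments.
Unset Strict Implicit.
Unset Printing Implicit Defensive.

(* Parallel edges are distinct elements of [edge] with the same [ends];
   two-element end sets exclude loops. *)
Record mgraph := MGraph {
  vertex : finType;
  edge : finType;
  ends : edge -> {set vertex};
  card_ends : forall e, #|ends e| = 2
}.

Definition degree (G : mgraph) (v : vertex G) : nat :=
  #|[set e : edge G | v \in ends e]|.

Record subgraph (G : mgraph) := Subgraph {
  sub_vertices : {set vertex G};
  sub_edges : {set edge G};
  sub_ends : forall e, e \in sub_edges -> ends e \subset sub_vertices
}.

Definition sub_degree (G : mgraph) (H : subgraph G) (v : vertex G) : nat :=
  #|[set e in sub_edges H | v \in ends e]|.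

Definition sub_max_degree (G : mgraph) (H : subgraph G) : nat :=
  \max_(v in sub_vertices H) sub_degree H v.

(* The parts [X] and [Y] may be empty. *)
Definition bipartite (G : mgraph) (B : subgraph G) : Prop :=
  exists X Y : {set vertex G},
    [/\ X :|: Y = sub_vertices B,
        [disjoint X & Y]
      & forall e, e \in sub_edges B ->
          exists x y, [/\ x \in X, y \in Y & ends e = [set x; y]]].

(* Either edge set may be empty, and the vertex sets may overlap. *)
Definition decomposes (G : mgraph) (B H : subgraph G) : Prop :=
  sub_edges B :|: sub_edges H = [set: edge G]
  /\ [disjoint sub_edges B & sub_edges H].

Record orientation (G : mgraph) := Orientation {
  tail : edge G -> vertex G;
  head : edge G -> vertex G;
  ends_orientation : forall e, ends e = [set tail e; head e]
}.

Definition outdegree (G : mgraph) (D : orientation G) (v : vertex G) : nat :=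
  #|[set e : edge G | tail D e == v]|.

Definition avoiding (G : mgraph) (F : vertex G -> set nat)
    (D : orientation G) : Prop :=
  forall v, ~ F v (outdegree D v).

(* |A| < d / 2. Finiteness is explicit because [fset_set] sends infinite sets
   to the empty one. *)
Definition card_lt_half (A : set nat) (d : nat) : Prop :=
  finite_set A /\ 2 * #|` fset_set A | < d.

(* Main.v *)
Require Import Defs.
From mathcomp Require Import all_boot finmap zify.
From mathcomp Require Import boolp classical_sets cardinality.

(** Fix an arbitrary orientation of [H] and look at the bipartite graph [B]
    alone.  The hypotheses give [2 * |F v| <= d_B v] at every vertex: this is
    immediate where [d_H v = 0]; where [d_H v = 1] the strict inequality
    [2 * |F v| < d_G v] absorbs the missing edge; where [d_H v = 2] both sides
    of that inequality are even, so that it has a slack of two.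

    Let [X] and [Y] be the sides of [B].  An orientation of [B] is the same
    thing as the set [J] of the edges that point from [X] to [Y], and the
    outdegree of [v] is then a constant plus [d_J v] if [v] is in [X], and a
    constant minus [d_J v] if [v] is in [Y].  Hence an [F]-avoiding orientation
    amounts to a set [J] of edges whose degree at each [v] misses a set of at
    most [|F v|] values.

    Such a [J] exists as soon as each edge can be assigned to one of its ends
    in such a way that [v] receives at least [|F v|] edges
    ([degree_avoiding_subset]), by a greedy argument due to Frank, Lau and
    Szabo.  Assigning each edge to its tail in an orientation whose outdegrees
    and indegrees differ by at most one ([balanced_orientation]) gives [v] at
    least half of its edges, rounded down, and this suffices. *)

Set Implicit Arguments.
Unset Strict Implicit.
Unset Printing Implicit Defensive.

Lemma card_setI_sum (E : finType) (S : {set E}) (P : pred E) :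
  #|[set e in S | P e]| = \sum_(e in S) P e.
Proof.
by rewrite -sum1dep_card big_mkcondr; apply: eq_bigr => e _; case: (P e).
Qed.

(** Induction on the number of edges by splitting off: two edges [v x] and
    [v y] are replaced with a single edge [x y], and an orientation of the
    latter from [x] to [y] is lifted to the path from [x] through [v] to [y],
    which leaves every difference of outdegree and indegree unchanged.  When
    no two edges meet, any orientation is balanced.  Splitting off creates
    loops, which is why they are allowed here: a loop counts once in the
    outdegree and once in the indegree. *)
Lemma balanced_orientation (V E : finType) (S : {set E}) (p : E -> V * V) :
  exists t : E -> V * V,
    (forall e, t e = p e \/ t e = ((p e).2, (p e).1)) /\
    forall v, \sum_(e in S) ((t e).1 == v) <= (\sum_(e in S) ((t e).2 == v)).+1
           /\ \sum_(e in S) ((t e).2 == v) <= (\sum_(e in S) ((t e).1 == v)).+1.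
Proof.
have [n] := ubnP #|S|; elim: n => // n IHn in S p *; rewrite ltnS => leSn.
pose inc (v : V) e := (v == (p e).1) || (v == (p e).2).
have incP v e : inc v e -> exists x, p e = (v, x) \/ p e = (x, v).
  rewrite /inc; case: (p e) => a b /= /orP[]/eqP->; first by exists b; left.
  by exists a; right.
have [|no_pair] := boolP [exists v, exists e in S, exists f in S,
    [&& e != f, inc v e & inc v f]]; last first.
  exists p; split=> [e|v]; first by left.
  have le1 (g : E -> V) : (forall e, inc (g e) e) ->
      \sum_(e in S) (g e == v) <= 1.
    move=> gP; rewrite -card_setI_sum leqNgt; apply/negP => /card_gt1P[e [f]].
    rewrite !inE => -[/andP[eS /eqP ge] /andP[fS /eqP gf] ef].
    case/negP: no_pair; apply/existsP; exists v.
    apply/existsP; exists e; rewrite eS /=; apply/existsP; exists f.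
    by rewrite fS ef -{1}ge -{1}gf !gP.
  have o1 := le1 (fun e => (p e).1) (fun e => introT orP (or_introl (eqxx _))).
  have i1 := le1 (fun e => (p e).2) (fun e => introT orP (or_intror (eqxx _))).
  by split; lia.
case/existsP=> v /existsP[e /andP[eS /existsP[f /andP[fS]]]].
case/and3P=> ef /incP[x pe] /incP[y pf].
have eSf : e \in S :\ f by rewrite !inE ef.
pose q g := if g == e then (x, y) else p g.
have [|t [tq balt]] := IHn (S :\ f) q.
  by apply: leq_trans leSn; rewrite [leqRHS](cardsD1 f) fS.
(* [te] and [tf] are the orientations of [e] and [f] lifted from [t e]. *)
have [te [tf [te_ok tf_ok out_ef in_ef]]] : exists te tf : V * V,
    [/\ te = p e \/ te = ((p e).2, (p e).1),
        tf = p f \/ tf = ((p f).2, (p f).1),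
        forall u, (te.1 == u) + (tf.1 == u) = ((t e).1 == u) + (v == u)
      & forall u, (te.2 == u) + (tf.2 == u) = ((t e).2 == u) + (v == u)].
  have := tq e; rewrite /q eqxx /= => -[]->.
    exists (x, v), (v, y); split=> [||u|u] /=; [ | | lia | lia].
      by case: pe => ->; auto.
    by case: pf => ->; auto.
  exists (v, x), (y, v); split=> [||u|u] /=; [ | | lia | lia].
    by case: pe => ->; auto.
  by case: pf => ->; auto.
exists (fun g => if g == e then te else if g == f then tf else t g).
split=> [g|u].
  have [->//|ge] := eqVneq g e; have [->//|gf] := eqVneq g f.
  by have := tq g; rewrite /q (negPf ge).
have lift_sum (c : V * V -> V) :
    (c te == u) + (c tf == u) = (c (t e) == u) + (v == u) ->
    \sum_(g in S) (c (if g == e then te else if g == f then tf else t g) == u)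
      = \sum_(g in S :\ f) (c (t g) == u) + (v == u).
  move=> c_ef; rewrite (big_setD1 f) // (big_setD1 e) //= [in RHS](big_setD1 e) //=.
  rewrite eqxx (eq_sym f e) (negPf ef) eqxx.
  rewrite (eq_bigr (fun g => c (t g) == u : nat)) => [|g]; first by lia.
  by rewrite !inE => /and3P[/negPf-> /negPf->].
have := balt u.
rewrite (lift_sum fst (out_ef u)) (lift_sum snd (in_ef u)).
by lia.
Qed.

(** The greedy argument of Frank, Lau and Szabo, which works for hypergraphs.
    If [0] is nowhere forbidden, then the empty set will do.  If it is
    forbidden at [v], then [v] owns some edge [e]; put [e] into [J], delete it,
    and shift the forbidden degrees at the vertices of [e] down by one.  This
    costs [v] an edge that it owns, but also removes the forbidden value [0],
    and the other vertices of [e] lose nothing. *)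
Lemma degree_avoiding_subset (V E : finType) (inc : E -> {set V})
    (owner : E -> V) (S : {set E}) (F : V -> seq nat) :
  (forall e, owner e \in inc e) ->
  (forall v, size (F v) <= \sum_(e in S) (owner e == v)) ->
  exists2 J : {set E}, J \subset S &
    forall v, \sum_(e in J) (v \in inc e) \notin F v.
Proof.
move=> ownerP; have [n] := ubnP #|S|.
elim: n => // n IHn in S F *; rewrite ltnS => leSn sizeF.
have [/existsP[v F0]|no0] := boolP [exists v, 0 \in F v]; last first.
  exists finset.set0; first exact: finset.sub0set.
  by move=> v; rewrite big_set0; apply: contra no0 => F0; apply/existsP; exists v.
have [e eS /eqP ov] : exists2 e, e \in S & owner e == v.
  apply/exists_inP; apply: contraLR F0; rewrite negb_exists_in => /forall_inP no_e.
  have := sizeF v; rewrite big1 => [|e eS]; last by rewrite (negPf (no_e e eS)).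
  by rewrite leqn0 size_eq0 => /eqP->.
pose F' u := [seq f - (u \in inc e) | f <- F u & (u \in inc e) <= f].
have [||J JS avJ] := IHn (S :\ e) F'.
- by apply: leq_trans leSn; rewrite [leqRHS](cardsD1 e) eS.
- move=> u; have := sizeF u; rewrite (big_setD1 e) //= ov size_map size_filter.
  have := count_size (fun f => (u \in inc e) <= f) (F u).
  have [<-{u}|_] := eqVneq v u; last by rewrite add0n => le_cs; apply: leq_trans.
  have ve : v \in inc e by rewrite -ov.
  rewrite {2}ve => _ le_own; rewrite -ltnS; apply: leq_trans le_own.
  rewrite -(count_predC (fun f => (v \in inc e) <= f) (F v)).
  rewrite ve -addn1 leq_add2l -has_count.
  by apply/hasP; exists 0.
have eJ : e \notin J by apply/negP => /(fintype.subsetP JS); rewrite !inE eqxx.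
exists (e |: J) => [|u].
  by rewrite finset.subUset finset.sub1set eS (fintype.subset_trans JS) ?finset.subD1set.
rewrite big_setU1 //=; apply: contra (avJ u) => Fu; apply/mapP.
exists ((u \in inc e) + \sum_(g in J) (u \in inc g)); last by rewrite addKn.
by rewrite mem_filter leq_addr.
Qed.

Lemma degree_sum (G : mgraph) (B H : subgraph G) (v : vertex G) :
  decomposes B H -> degree v = sub_degree B v + sub_degree H v.
Proof.
case=> BH disBH; rewrite /degree /sub_degree -cardsUI.
have -> : [set e in sub_edges B | v \in ends e]
    :&: [set e in sub_edges H | v \in ends e] = finset.set0.
  apply/finset.setP => e; rewrite !inE; apply/negP => /andP[/andP[eB _] /andP[eH _]].
  by rewrite (disjointFr disBH eB) in eH.
rewrite cards0 addn0; congr #|pred_of_set _|; apply/finset.setP => e; rewrite !inE -andb_orl.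
by have := finset.in_setT e; rewrite -BH inE => ->.
Qed.

Lemma sub_degree_out (G : mgraph) (H : subgraph G) (v : vertex G) :
  v \notin sub_vertices H -> sub_degree H v = 0.
Proof.
move=> vH; apply/eqP; rewrite cards_eq0; apply/eqP/finset.setP => e; rewrite !inE.
apply: contraNF vH => /andP[eH ve]; exact: (fintype.subsetP (sub_ends eH)).
Qed.

Lemma sub_degree_le_max (G : mgraph) (H : subgraph G) (v : vertex G) :
  sub_degree H v <= sub_max_degree H.
Proof.
have [vH|/sub_degree_out->//] := boolP (v \in sub_vertices H).
exact: leq_bigmax_cond.
Qed.

(** Orient the edges of [B] that lie in [J] away from [X], the other edges of
    [B] towards [X], and the edges outside [B] as in [D].  The second equation
    is additive because subtraction on [nat] is truncated. *)
Lemma orientation_of_subset (G : mgraph) (B : subgraph G) (D : orientation G)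
    (X : {set vertex G}) (J : {set edge G}) :
  (forall e, e \in sub_edges B -> (tail D e \in X) != (Defs.head D e \in X)) ->
  J \subset sub_edges B ->
  exists D' : orientation G, forall v,
    let out := \sum_(e in ~: sub_edges B) (tail D e == v) in
    let dJ := \sum_(e in J) (v \in ends e) in
    if v \in X then outdegree D' v = out + dJ
    else outdegree D' v + dJ = out + sub_degree B v.
Proof.
move=> crossB JB.
pose keep e := (e \in sub_edges B) ==> ((tail D e \in X) == (e \in J)).
pose t e := if keep e then tail D e else Defs.head D e.
pose h e := if keep e then Defs.head D e else tail D e.
have th e : ends e = [set t e; h e].
  by rewrite /t /h (ends_orientation D); case: (keep e); rewrite // finset.setUC.
exists (Orientation th) => v out dJ.
have -> : outdegree (Orientation th) v
    = out + \sum_(e in sub_edges B) (t e == v).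
  transitivity (\sum_e (t e == v)).
    rewrite /outdegree -sum1dep_card big_mkcond.
    by apply: eq_bigr => e _; rewrite /=; case: (t e == v).
  rewrite (bigID (mem (sub_edges B))) /= addnC; congr (_ + _).
  rewrite /out; apply: eq_big => e; first by rewrite inE.
  by rewrite /t /keep => /negPf->.
have dJE : dJ = \sum_(e in sub_edges B) (e \in J) && (v \in ends e).
  rewrite -card_setI_sum /dJ -card_setI_sum; apply: eq_card => e; rewrite !inE.
  by case eJ: (e \in J); rewrite /= ?andbF // (fintype.subsetP JB).
have tE e : e \in sub_edges B ->
    (t e == v) = (v \in ends e) && ((v \in X) == (e \in J)).
  move=> eB; rewrite (ends_orientation D) !inE /t /keep eB /= !(eq_sym v).
  have := crossB e eB.
  have [tv|nt] := eqVneq (tail D e) v; have [hv|nh] := eqVneq (Defs.head D e) v.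
  - by rewrite tv hv eqxx.
  - rewrite tv; case: (v \in X); case: (e \in J);
      by rewrite /= ?eqxx ?(negPf nh).
  - rewrite hv; case: (tail D e \in X); case: (v \in X); case: (e \in J);
      by rewrite //= ?hv ?eqxx ?(negPf nt).
  - by case: ifP => _ _; rewrite /= ?(negPf nt) ?(negPf nh).
rewrite (eq_bigr _ (fun e eB => congr1 nat_of_bool (tE e eB))) dJE.
case: (v \in X).
  by congr (_ + _); apply: eq_bigr => e _; rewrite andbC; case: (e \in J).
rewrite -addnA /sub_degree card_setI_sum -big_split /=; congr (_ + _).
by apply: eq_bigr => e _; case: (v \in ends e); case: (e \in J).
Qed.

Theorem theorem5 (G : mgraph) (F : vertex G -> set nat)
    (cardF : forall v, card_lt_half (F v) (degree v))
    (B H : subgraph G)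
    (decBH : decomposes B H)
    (bipB : bipartite B)
    (maxH : sub_max_degree H <= 2)
    (evenH : forall v, v \in sub_vertices H -> sub_degree H v = 2 ->
       degree v = 0 %[mod 2]) :
  exists D : orientation G, avoiding F D.
Proof.
have halfB v : 2 * #|` fset_set (F v)| <= sub_degree B v.
  have [_] := cardF v; have := degree_sum v decBH.
  have := leq_trans (sub_degree_le_max H v) maxH.
  have [/evenH|/sub_degree_out->] := boolP (v \in sub_vertices H); last by lia.
  by have [->|] := eqVneq (sub_degree H v) 2; [move=> /(_ erefl)|]; lia.
have /choice[p pE] : forall e : edge G,
    exists q, ends e = [set q.1; q.2] /\ q.1 != q.2.
  move=> e; have /eqP/cards2P[x [y [xy ->]]] := card_ends e.
  by exists (x, y).
have [t [tp balt]] := balanced_orientation (sub_edges B) p.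
have tE e : ends e = [set (t e).1; (t e).2] /\ (t e).1 != (t e).2.
  by have [pe ne] := pE e; case: (tp e) => -> /=; rewrite // finset.setUC eq_sym.
pose D := Orientation (fun e => (tE e).1).
have {}halfB v : #|` fset_set (F v)| <= \sum_(e in sub_edges B) (tail D e == v).
  have [_] := balt v; have := halfB v; rewrite /sub_degree card_setI_sum.
  rewrite (eq_bigr (fun e => ((t e).1 == v) + ((t e).2 == v))) => [|e _].
    by rewrite big_split /=; lia.
  have [-> ne] := tE e; rewrite !inE !(eq_sym v).
  by have [<-|] := eqVneq (t e).1 v; rewrite // eq_sym (negPf ne).
case: bipB => X [Y [_ disXY bipB]].
have crossB e : e \in sub_edges B -> (tail D e \in X) != (Defs.head D e \in X).
  move=> /bipB[x [y [xX yY]]]; have [-> ne] := tE e.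
  have yX := disjointFl disXY yY => exy.
  have : (t e).1 \in [set x; y] by rewrite -exy !inE eqxx.
  have : (t e).2 \in [set x; y] by rewrite -exy !inE eqxx orbT.
  rewrite !inE /= => /orP[]/eqP h /orP[]/eqP t1;
    by move: ne; rewrite h t1 ?eqxx ?xX ?yX.
pose out v := \sum_(e in ~: sub_edges B) (tail D e == v).
(* The degrees in [J] that would put the outdegree into [F v].  Truncated
   subtraction may forbid [0] needlessly, but does not lengthen the list. *)
pose bad v := [seq if v \in X then f - out v else out v + sub_degree B v - f
              | f <- fset_set (F v)].
have [||J JB avJ] := @degree_avoiding_subset _ _ (@ends G) (tail D) (sub_edges B) bad.
- by move=> e; rewrite (ends_orientation D) !inE eqxx.
- by move=> v; rewrite size_map; apply: halfB.
have [D' outD'] := orientation_of_subset crossB JB.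
exists D' => v Fv; have /negP := avJ v; apply; apply/mapP.
exists (outdegree D' v).
  by rewrite in_fset_set ?inE //; case: (cardF v).
by have := outD' v; rewrite /= -/(out v); case: (v \in X); lia.
Qed.
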